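(* Let $X$ and $Y$ be Banach spaces and suppose $Y$ has HIC$_p$ for some $p\in(1,\infty)$. If there is a coarse map $f\colon X\to Y$ which is linearly expanding at rate $\frac1p$, then $X$ has HIC$_p$.
   Context: For $k\in\mathbb N$ and an infinite $\mathbb M\subseteq\mathbb N$, $[\mathbb M]^k$ denotes the set of all $k$-element subsets of $\mathbb M$, written $\bar n=(n_1,\dots,n_k)$ with $n_1<\dots<n_k$. The Hamming metric on $[\mathbb N]^k$ is $d_{\mathbb H}(\bar n,\bar m)=|\{i\in\{1,\dots,k\}: n_i\ne m_i\}|$. The set of strictly interlacing pairs is $I_k(\mathbb M)=\{(\bar n,\bar m)\in[\mathbb M]^k\times[\mathbb M]^k : n_1<m_1<n_2<m_2<\dots<n_k<m_k\}$. For $p\in(1,\infty]$, a Banach space $X$ has HIC$_p$ (the Hamming interlaced concentration property for $p$) if there is $C\ge1$ such that for any $k\in\mathbb N$ and any $1$-Lipschitz map $\phi\colon([\mathbb N]^k,d_{\mathbb H})\to X$ there is an infinite $\mathbb M\subseteq\mathbb N$ such that $\|\phi(\bar n)-\phi(\bar m)\|\le Ck^{1/p}$ for all $(\bar n,\bar m)\in I_k(\mathbb M)$ (with $1/\infty=0$). A map $f\colon X\to Y$ between Banach spaces is coarse if $\omega_f(t)=\sup\{\|f(x)-f(z)\| : \|x-z\|\le t\}<\infty$ for all $t\ge 0$. For $\alpha\in[0,1]$, a map $f\colon X\to Y$ between Banach spaces is linearly expanding at rate $\alpha$ if for every $L>0$ there is $C>0$ such that, for all $x,z\in X$, $\|x-z\|\ge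 L\max\{\|x\|^\alpha,\|z\|^\alpha\}+L$ implies $\|f(x)-f(z)\|\ge\frac1C\|x-z\|-C$. *)

(* Defs.v *)
From HB Require Import structures.
From mathcomp Require Import all_boot all_order all_algebra.
From mathcomp Require Import all_classical all_reals all_analysis.
Set Implicit Arguments.
Unset Strict Implicit.
Unset Printing Implicit Defensive.
Import Order.TTheory GRing.Theory Num.Theory.
Import numFieldNormedType.Exports.
Local Open Scope classical_set_scope.
Local Open Scope ring_scope.

(* A k-element subset of M is encoded by its increasing enumeration. *)
Definition ksubsets (M : set nat) (k : nat) : set (k.-tuple nat) :=
  [set n : k.-tuple nat | sorted ltn n /\ forall i : 'I_k, M (tnth n i)].

Definition hamming (k : nat) (n m : k.-tuple nat) : nat :=
  #|[pred i : 'I_k | tnth n i != tnth m i]|.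

Definition interlacing (M : set nat) (k : nat) :
    set (k.-tuple nat * k.-tuple nat) :=
  [set nm | [/\ ksubsets M nm.1, ksubsets M nm.2,
    forall i : 'I_k, (tnth nm.1 i < tnth nm.2 i)%N &
    forall i j : 'I_k, j = i.+1 :> nat -> (tnth nm.2 i < tnth nm.1 j)%N]].

(* Maps on [N]^k are represented by functions on all k-tuples, whose values at
   tuples that are not strictly increasing are irrelevant. *)
Definition hamming_lipschitz1 (R : realType) (X : normedModType R) (k : nat)
    (phi : k.-tuple nat -> X) : Prop :=
  forall n m : k.-tuple nat, ksubsets setT n -> ksubsets setT m ->
    `|phi n - phi m| <= (hamming n m)%:R.

(* 1/p with 1/oo = 0; only used for 1 < p, so the value at -oo is junk. *)
Definition inv_exponent (R : realType) (p : \bar R) : R :=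
  if p is EFin r then r^-1 else 0.

Definition HIC (R : realType) (p : \bar R) (X : normedModType R) : Prop :=
  exists2 C : R, 1 <= C &
    forall (k : nat) (phi : k.-tuple nat -> X), (0 < k)%N ->
      hamming_lipschitz1 phi ->
      exists2 M : set nat, infinite_set M &
        forall n m : k.-tuple nat, interlacing M (n, m) ->
          `|phi n - phi m| <= C * k%:R `^ inv_exponent p.

Definition expansion_modulus (R : realType) (X Y : normedModType R)
    (f : X -> Y) (t : R) : \bar R :=
  ereal_sup [set `|f xz.1 - f xz.2|%:E | xz in
    [set xz : X * X | `|xz.1 - xz.2| <= t]].

Definition coarse (R : realType) (X Y : normedModType R) (f : X -> Y) : Prop :=
  forall t : R, 0 <= t -> (expansion_modulus f t < +oo)%E.

Definition linearly_expanding (R : realType) (X Y : normedModType R)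
    (alpha : R) (f : X -> Y) : Prop :=
  forall L : R, 0 < L -> exists2 C : R, 0 < C &
    forall x z : X,
      L * Num.max (`|x| `^ alpha) (`|z| `^ alpha) + L <= `|x - z| ->
      C^-1 * `|x - z| - C <= `|f x - f z|.

(* Main.v *)
Require Import Defs.
From HB Require Import structures.
From mathcomp Require Import all_boot all_order all_algebra.
From mathcomp Require Import all_classical all_reals all_analysis.
From mathcomp Require Import ring lra.
Import Order.TTheory GRing.Theory Num.Theory.
Import numFieldNormedType.Exports.
Local Open Scope classical_set_scope.
Local Open Scope ring_scope.

(** A coarse map is Lipschitz for integer-valued upper bounds of the distance,
    so after translating a 1-Lipschitz map phi to have norm at most k, its
    composite with f is Lipschitz and concentrates in Y at scale k^(1/p).
    Where phi(n) and phi(m) are at distance at least of the order of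
    k^(1/p) >= max (|phi(n)|, |phi(m)|)^(1/p), the expansion condition pulls
    this estimate back to X; elsewhere there is nothing to prove. *)

Lemma coarse_bound (R : realType) (X Y : normedModType R) (f : X -> Y) (t : R) :
  0 <= t -> coarse f ->
  exists2 D : R, 0 < D & forall x z, `|x - z| <= t -> `|f x - f z| <= D.
Proof.
move=> t0 /(_ t t0) fin.
have ub x z : `|x - z| <= t -> (`|f x - f z|%:E <= expansion_modulus f t)%E.
  by move=> xz; apply: ereal_sup_ubound; exists (x, z).
move: fin ub; case: (expansion_modulus f t) => [r _ ub|//|_ ub].
(* The maximum with 1 makes the bound positive, so that it can serve as a divisor. *)
- exists (Num.max r 1) => [|x z /ub]; first by rewrite lt_max ltr01 orbT.
  by rewrite lee_fin le_max => ->.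
- by exists 1 => // x z /ub; rewrite leeNy_eq.
Qed.

(** Segments of a normed space can be cut into [d] pieces of length at most 1, and the bound [D] is
    paid once per piece. *)
Lemma unit_bound_lipschitz (R : realType) (X Y : normedModType R) (f : X -> Y)
    (D : R) :
  (forall x z, `|x - z| <= 1 -> `|f x - f z| <= D) ->
  forall (d : nat) x z, `|x - z| <= d%:R -> `|f x - f z| <= D * d%:R.
Proof.
move=> fD; elim=> [|d IHd] x z xz.
  move: xz; rewrite normr_le0 subr_eq0 => /eqP->.
  by rewrite subrr normr0 mulr0.
have d1 : 0 < d.+1%:R :> R by [].
have dE : d.+1%:R = d%:R + 1 :> R by rewrite -natr1.
(* The first cut point: one unit step from [x] leaves the fraction [d / (d + 1)] of the segment. *)
pose w := x - d.+1%:R^-1 *: (x - z).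
have xw : `|x - w| <= 1.
  rewrite subKr normrZ gtr0_norm ?invr_gt0//.
  by rewrite mulrC ler_pdivrMr// mul1r.
have wz : `|w - z| <= d%:R.
  have -> : w - z = (d%:R / d.+1%:R) *: (x - z).
    rewrite /w addrAC; have -> : d%:R / d.+1%:R = 1 - d.+1%:R^-1 :> R.
      by move: (lt0r_neq0 d1); rewrite dE => ?; field.
    by rewrite scalerBl scale1r.
  rewrite normrZ ger0_norm ?divr_ge0// mulrAC ler_pdivrMr//.
  exact: ler_wpM2l.
rewrite -(subrKA (f w)) (le_trans (ler_normD _ _))// dE mulrDr mulr1 addrC.
by apply: lerD; [exact: IHd|exact: fD].
Qed.

Lemma hamming_le (k : nat) (n m : k.-tuple nat) : (hamming n m <= k)%N.
Proof. by rewrite /hamming -[leqRHS]card_ord max_card. Qed.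

Lemma ksubsets_iota (k : nat) : ksubsets setT [tuple of iota 0 k].
Proof. by split=> //; exact: iota_ltn_sorted. Qed.

Lemma ksubsetsT (M : set nat) (k : nat) (n : k.-tuple nat) :
  ksubsets M n -> ksubsets setT n.
Proof. by case. Qed.

Theorem theorem4p10 (R : realType) (X Y : completeNormedModType R) (p : R)
    (hp : 1 < p) (hY : HIC p%:E Y)
    (hf : exists2 f : X -> Y, coarse f & linearly_expanding p^-1 f) :
  HIC p%:E X.
Proof.
have [CY CY1 hic] := hY.
have [f fcoarse /(_ 1 ltr01)[c c0 fexp]] := hf.
have [D D0 /unit_bound_lipschitz fD] := coarse_bound _ _ _ _ _ ler01 fcoarse.
have CY0 : 0 < CY by exact: lt_le_trans CY1.
have cc0 : 0 <= c * c by rewrite mulr_ge0// ltW.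
have cD0 : 0 <= c * D * CY by rewrite !mulr_ge0// ltW.
(* The 2 serves the near case; the rest comes from solving [c^-1 * s - c <= D * CY * t] for [s],
   where [t >= 1] is the power of [k]. *)
exists (2 + c * c + c * D * CY) => [|k phi k0 philip]; first by lra.
pose psi n := phi n - phi [tuple of iota 0 k].
have psiB n m : psi n - psi m = phi n - phi m by rewrite /psi opprB addrA subrK.
have psik n : ksubsets setT n -> `|psi n| <= k%:R.
  move=> nk; apply: (le_trans (philip _ _ nk (ksubsets_iota k))).
  by rewrite ler_nat hamming_le.
(* Dividing by [D] makes the composite 1-Lipschitz; Hamming distances are integers, so [fD]
   applies. *)
have [|M Minf hM] := hic k (fun n => D^-1 *: f (psi n)) k0.
  move=> n m nk mk; rewrite -scalerBr normrZ gtr0_norm ?invr_gt0//.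
  by rewrite mulrC ler_pdivrMr// mulrC fD// psiB philip.
exists M => // n m nm; move: (hM n m nm).
rewrite -scalerBr normrZ gtr0_norm ?invr_gt0// mulrC ler_pdivrMr//=.
have [/ksubsetsT nk /ksubsetsT mk _ _] := nm.
have pV0 : 0 <= p^-1 by rewrite invr_ge0 (le_trans ler01) ?ltW.
have powk x : 0 <= x -> x <= k%:R -> x `^ p^-1 <= k%:R `^ p^-1.
  by move=> x0 xk; rewrite ge0_ler_powR// nnegrE.
have t1 : 1 <= k%:R `^ p^-1 by have := powk 1 ler01; rewrite powR1 ler1n; apply.
have maxk : Num.max (`|psi n| `^ p^-1) (`|psi m| `^ p^-1) <= k%:R `^ p^-1.
  by rewrite ge_max !powk// psik.
rewrite -psiB; move: (k%:R `^ p^-1) t1 maxk => t t1 maxk fnm.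
(* As [t >= 1], the additive constant [c * c] is absorbed into [c * c * t]; likewise the near bound
   [t + 1] is at most [2 * t]. *)
have cct : 0 <= c * c * (t - 1) by rewrite mulr_ge0// subr_ge0.
have cDt : 0 <= c * D * CY * t by rewrite mulr_ge0// (le_trans ler01).
have [/fexp far|near] := leP (1 * Num.max (`|psi n| `^ p^-1)
  (`|psi m| `^ p^-1) + 1) `|psi n - psi m|; last by lra.
have := le_trans far fnm.
by rewrite lerBlDr mulrC ler_pdivrMr// => ?; lra.
Qed.
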